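(* Let $P$ be an irreducible Markov kernel on a finite set $V$ and let $\mu$ be its invariant probability. Then for every $x\in\mathcal{H}(P)$, $\mu(x)=\min_{V}\mu$.
   Context: A Markov kernel on a finite set $V$ is a $V\times V$ matrix with non-negative entries and row sums equal to 1; it is irreducible if all entries of $\sum_{n=1}^{|V|}P^n$ are positive. $\mathcal{K}(P)$ is the set of Markov kernels $K$ on $V$ with $KP=PK$. For $x\in V$, $\mathcal{K}(P,x)=\{K(x,\cdot):K\in\mathcal{K}(P)\}\subset\mathcal{P}(V)$, where $\mathcal{P}(V)$ is the set of probability measures on $V$. Finally $\mathcal{H}(P)=\{x\in V:\mathcal{K}(P,x)=\mathcal{P}(V)\}$. *)

(* Defs.v *)
From mathcomp Require Import all_boot all_order all_algebra.
From mathcomp Require Import classical_sets reals.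

Set Implicit Arguments.
Unset Strict Implicit.
Unset Printing Implicit Defensive.

Import Order.TTheory GRing.Theory Num.Theory.
Local Open Scope classical_set_scope.
Local Open Scope ring_scope.

(* A V x V matrix is a matrix in 'M[R]_#|V|, the bijection
   enum_rank : V -> 'I_#|V| giving its indexing by V: the (x, y) entry of P is
   P (enum_rank x) (enum_rank y). Measures on V are row vectors. *)

Definition mass (R : realType) (V : finType) (mu : 'rV[R]_#|V|) (x : V) : R :=
  mu 0 (enum_rank x).

Definition probabilities (R : realType) (V : finType) : set 'rV[R]_#|V| :=
  [set mu | (forall x, 0 <= mass mu x) /\ \sum_(x : V) mass mu x = 1].
Arguments probabilities : clear implicits.

Definition kernel_row (R : realType) (V : finType) (P : 'M[R]_#|V|) (x : V) :
    'rV[R]_#|V| :=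
  row (enum_rank x) P.

Definition markov_kernels (R : realType) (V : finType) : set 'M[R]_#|V| :=
  [set P | forall x : V, (forall y : V, 0 <= mass (kernel_row P x) y) /\
                         \sum_(y : V) mass (kernel_row P x) y = 1].
Arguments markov_kernels : clear implicits.

Definition irreducible_kernel (R : realType) (V : finType) (P : 'M[R]_#|V|) :
    Prop :=
  forall x y : V,
    0 < (\sum_(1 <= n < #|V|.+1) P ^+ n) (enum_rank x) (enum_rank y).

Definition commuting_kernels (R : realType) (V : finType) (P : 'M[R]_#|V|) :
    set 'M[R]_#|V| :=
  [set K | markov_kernels R V K /\ K *m P = P *m K].

Definition commuting_rows (R : realType) (V : finType) (P : 'M[R]_#|V|)
    (x : V) : set 'rV[R]_#|V| :=
  [set kernel_row K x | K in commuting_kernels P].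

(* The set H(P). *)
Definition full_points (R : realType) (V : finType) (P : 'M[R]_#|V|) : set V :=
  [set x | commuting_rows P x = probabilities R V].

Definition invariant_probability (R : realType) (V : finType)
    (P : 'M[R]_#|V|) (mu : 'rV[R]_#|V|) : Prop :=
  probabilities R V mu /\ mu *m P = mu.

(* Main.v *)
Require Import Defs.
From mathcomp Require Import all_boot all_order all_algebra.
From mathcomp Require Import classical_sets reals.

Set Implicit Arguments.
Unset Strict Implicit.
Unset Printing Implicit Defensive.

Import Order.TTheory GRing.Theory Num.Theory.
Local Open Scope ring_scope.

(** If [K] commutes with [P], then [mu *m K] is again an invariant probability,
    so [mu *m K = mu] by irreducibility.  For [x] in H(P) and any [y], choose
    [K] with [K(x, .)] the Dirac mass at [y]; then
    [mu y = sum_z mu z * K(z, y) >= mu x * K(x, y) = mu x]. *)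

(** Coordinate [j] of the eigenvector equation says that the nonnegative terms [v 0 k * A k j] sum
    to [c * 0 = 0]. Each term is therefore zero, and [A k j > 0] forces [v 0 k = 0]. *)
Lemma positive_mx_eigen_eq0 (R : numDomainType) (n : nat) (A : 'M[R]_n)
    (c : R) (v : 'rV[R]_n) (j : 'I_n) :
  (forall i k, 0 < A i k) -> v *m A = c *: v ->
  (forall i, 0 <= v 0 i) -> v 0 j = 0 -> v = 0.
Proof.
move=> Apos vA v0 vj; apply/rowP => i; rewrite mxE.
have /eqP := congr1 (fun w : 'rV[R]_n => w 0 j) vA.
rewrite !mxE vj mulr0 psumr_eq0 => [/allP/(_ i)|k _]; last first.
  by rewrite mulr_ge0 // ltW.
by rewrite mem_index_enum mulf_eq0 (gt_eqF (Apos i j)) orbF => /(_ isT)/eqP.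
Qed.

(** The uniqueness half of Perron-Frobenius: subtracting from [w] the largest multiple of [v] that
    keeps it nonnegative creates a zero coordinate, so nothing remains. Hence [w] is proportional to
    [v], and the normalisation makes them equal. *)
Lemma positive_mx_eigen_uniq (R : realFieldType) (n : nat) (A : 'M[R]_n)
    (c : R) (v w : 'rV[R]_n) :
  (forall i k, 0 < A i k) -> v *m A = c *: v -> w *m A = c *: w ->
  (forall i, 0 <= v 0 i) -> (forall i, 0 <= w 0 i) ->
  \sum_i v 0 i = 1 -> \sum_i w 0 i = 1 -> v = w.
Proof.
move=> Apos vA wA v0 w0 v1 w1.
have vpos i : 0 < v 0 i.
  rewrite lt_neqAle v0 andbT eq_sym; apply/eqP => vi.
  have v_eq0 := positive_mx_eigen_eq0 Apos vA v0 vi.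
  move: v1; rewrite v_eq0 big1 => [/esym/eqP|k _]; first by rewrite oner_eq0.
  by rewrite mxE.
(* The arg min below needs a starting index [i0]; for [n = 0] the rows are trivially equal. *)
case: (pickP 'I_n) => [i0 _|I0]; last by apply/rowP => i; have := I0 i.
pose j := [arg min_(i < i0) (w 0 i / v 0 i)]%O.
have jmin i : w 0 j / v 0 j <= w 0 i / v 0 i.
  by rewrite /j; case: arg_minP => // k _; apply.
(* The ratio [w / v] is minimal at [j], so this combination is a nonnegative
   eigenvector vanishing at [j]. *)
pose e := v 0 j *: w - w 0 j *: v.
have e0 : e = 0.
  apply: (@positive_mx_eigen_eq0 _ _ A c e j) => //.
  - by rewrite mulmxBl -!scalemxAl vA wA scalerBr !scalerA ![c * _]mulrC.
  - move=> i; rewrite !mxE subr_ge0.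
    by have := jmin i; rewrite ler_pdivrMr // mulrAC ler_pdivlMr // [w 0 i * _]mulrC.
  - by rewrite !mxE mulrC subrr.
have eE i : v 0 j * w 0 i = w 0 j * v 0 i.
  have := congr1 (fun u : 'rV[R]_n => u 0 i) e0.
  by rewrite !mxE => /eqP; rewrite subr_eq0 => /eqP.
(* Sum [eE] over all [i]; both total masses are 1. *)
have vwj : v 0 j = w 0 j.
  rewrite -[LHS]mulr1 -w1 -[RHS]mulr1 -v1 !mulr_sumr.
  by apply: eq_bigr => i _.
apply/rowP => i; apply: (mulfI (lt0r_neq0 (vpos j))).
by rewrite eE vwj.
Qed.

Lemma sum_mass (R : realType) (V : finType) (v : 'rV[R]_#|V|) :
  \sum_(x : V) mass v x = \sum_i v 0 i.
Proof. by rewrite (reindex _ (onW_bij _ (@enum_rank_bij V))). Qed.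

Lemma mass_ge0 (R : realType) (V : finType) (v : 'rV[R]_#|V|) :
  (forall x, 0 <= mass v x) -> forall i, 0 <= v 0 i.
Proof. by move=> v0 i; have := v0 (enum_val i); rewrite /mass enum_valK. Qed.

Lemma invariant_mulmx_sum_exp (R : pzRingType) (n N : nat) (P : 'M[R]_n)
    (v : 'rV[R]_n) :
  v *m P = v -> v *m (\sum_(1 <= k < N.+1) P ^+ k) = N%:R *: v.
Proof.
move=> vP.
have vPk k : v *m P ^+ k = v.
  by elim: k => [|k IHk]; rewrite ?expr0 ?mulmx1 // exprS -mulmxE mulmxA vP.
rewrite mulmx_sumr (eq_bigr (fun=> v)) => [|k _]; last exact: vPk.
by rewrite big_const_nat subSS subn0 iter_addr_0 scaler_nat.
Qed.

(** Irreducibility makes the sum of the powers of [P] a positive matrix, and every row vector fixed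
    by [P] is a left eigenvector of that sum for the eigenvalue [#|V|], the number of powers. *)
Lemma invariant_probability_uniq (R : realType) (V : finType)
    (P : 'M[R]_#|V|) (mu nu : 'rV[R]_#|V|) :
  irreducible_kernel P ->
  invariant_probability P mu -> invariant_probability P nu -> mu = nu.
Proof.
move=> irr [[mu0 mu1] muP] [[nu0 nu1] nuP].
apply: (positive_mx_eigen_uniq (A := \sum_(1 <= n < #|V|.+1) P ^+ n)
  (c := #|V|%:R)).
- by move=> i k; have := irr (enum_val i) (enum_val k); rewrite !enum_valK.
- exact: invariant_mulmx_sum_exp.
- exact: invariant_mulmx_sum_exp.
- exact: mass_ge0.
- exact: mass_ge0.
- by rewrite -sum_mass.
- by rewrite -sum_mass.
Qed.

Lemma markov_kernel_ge0 (R : realType) (V : finType) (K : 'M[R]_#|V|) :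
  markov_kernels R V K -> forall i j, 0 <= K i j.
Proof.
move=> hK i j; have [K0 _] := hK (enum_val i).
by have := mass_ge0 K0 j; rewrite mxE enum_valK.
Qed.

Lemma probability_mulmx_kernel (R : realType) (V : finType)
    (K : 'M[R]_#|V|) (mu : 'rV[R]_#|V|) :
  markov_kernels R V K -> probabilities R V mu -> probabilities R V (mu *m K).
Proof.
move=> hK [mu0 mu1]; split=> [x|].
  rewrite /mass mxE sumr_ge0 // => i _.
  by rewrite mulr_ge0 ?mass_ge0 ?markov_kernel_ge0.
rewrite sum_mass -[RHS]mu1 sum_mass.
under eq_bigr do rewrite mxE.
(* After the exchange, each [mu 0 i] is multiplied by the sum of row [i] of [K], which is 1. *)
rewrite exchange_big /=; apply: eq_bigr => i _; rewrite -mulr_sumr.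
have [_] := hK (enum_val i); rewrite sum_mass.
under eq_bigr do rewrite mxE enum_valK.
by move=> ->; rewrite mulr1.
Qed.

Lemma invariant_probability_commuting (R : realType) (V : finType)
    (P K : 'M[R]_#|V|) (mu : 'rV[R]_#|V|) :
  irreducible_kernel P -> invariant_probability P mu ->
  commuting_kernels P K -> mu *m K = mu.
Proof.
move=> irr hmu [hK KP]; apply: (invariant_probability_uniq irr) => //.
case: hmu => mu_prob muP; split; first exact: probability_mulmx_kernel.
by rewrite -mulmxA KP mulmxA muP.
Qed.

Lemma dirac_probability (R : realType) (V : finType) (y : V) :
  probabilities R V (delta_mx 0 (enum_rank y)).
Proof.
split=> [x|]; first by rewrite /mass mxE ler0n.
rewrite sum_mass (bigD1 (enum_rank y)) //= big1 => [|i /negPf yi].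
  by rewrite mxE !eqxx addr0.
by rewrite mxE yi andbF.
Qed.

Theorem proposition4 (R : realType) (V : finType) (P : 'M[R]_#|V|)
    (mu : 'rV[R]_#|V|)
    (hP : markov_kernels R V P) (hirr : irreducible_kernel P)
    (hmu : invariant_probability P mu) :
  forall x : V, full_points P x ->
    mass mu x = \big[Num.min/mass mu x]_(y : V) mass mu y.
Proof.
(* The default value of the minimum is [mass mu x], which gives one inequality at once; what is left
   is [mass mu x <= mass mu y] for each [y]. *)
move=> x hx; apply/esym/le_anti; rewrite bigmin_le_id /=.
apply/bigmin_geP; split=> // y _.
have : commuting_rows P x (delta_mx 0 (enum_rank y)).
  by rewrite hx; exact: dirac_probability.
case=> K hK Kx.
have Kxy : K (enum_rank x) (enum_rank y) = 1.
  have := congr1 (fun w : 'rV[R]_#|V| => w 0 (enum_rank y)) Kx.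
  by rewrite !mxE !eqxx.
have muK := invariant_probability_commuting hirr hmu hK.
case: hmu hK => -[mu0 _] _ [Kmarkov _].
rewrite -[in leRHS]muK {2}/mass mxE (bigD1 (enum_rank x)) //= Kxy mulr1.
rewrite lerDl sumr_ge0 // => i _.
by rewrite mulr_ge0 ?mass_ge0 ?markov_kernel_ge0.
Qed.
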